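(* There exist constants $c>0$ and $N_0$ such that for all $N\ge N_0$ and all positive integers $m,p,H,D$: if some $f\in\mathcal{TG}^{D,H}_{N,m,1,p}$ (a standard, i.e. second-order, graph transformer) satisfies $f(X)=\mathrm{Cycle5}(X)$ for all $X\in\{0,1\}^{N\times N}$ with $X=X^{\mathsf T}$, then $mpHD\ge cN/\log^2N$.
   Context: The input $X\in\{0,1\}^{N\times N}$ is the adjacency matrix of a graph on $[N]=\{1,\dots,N\}$, $x_{i,j}=1$ iff $(i,j)$ is an edge; row $x_i$ is the embedding of vertex $i$. For symmetric $X$, $\mathrm{Cycle5}(X)\in\{0,1\}^N$ is given by $\mathrm{Cycle5}(X)_i=1$ if there exist $j_1,j_2,j_3,j_4\in[N]$ with $x_{i,j_1}x_{j_1,j_2}x_{j_2,j_3}x_{j_3,j_4}x_{j_4,i}=1$, and $0$ otherwise. Graph self-attention (second order). Let $X$ be the adjacency matrix given as input to the whole network and $Y\in\mathbb{R}^{N\times d}$ the current sequence of embeddings. For $Q,K\in\mathbb{R}^{d\times m}$, $V\in\mathbb{R}^{d\times d'}$ encoded with $p$-bit fixed-point numbers and a function $\kappa:\{0,1\}^2\times\mathbb{R}\to\mathbb{R}$, a graph self-attention unit outputs $\mathrm{softmax}(\kappa(X,YQK^{\mathsf T}Y^{\mathsf T}))\,YV\in\mathbb{R}^{N\times d'}$, where $\kappa(X,A)_{i,j}=\kappa(x_{i,j},x_{j,i},A_{i,j})$ and softmax is row-wise: $\mathrm{softmax}(A)_{i,j}=\exp(A_{i,j})/\sum_{j'}\exp(A_{i,j'})$.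 An $H$-headed layer is a sum of $H$ such units. MLP layer. $\Phi_{d,d',p}$ is the set of all (arbitrary) functions $\phi:\mathbb{R}^d\to\mathbb{R}^{d'}$ whose real-valued inputs and outputs can be represented using $p$-bit fixed-precision numbers, applied row-wise. $\mathcal{TG}^{D,H}_{d,m,d',p}$ is the set of graph transformers of depth $D$: compositions of $D$ blocks, each an MLP layer (from $\Phi_{d,m,p}$ in the first block, $\Phi_{m,m,p}$ in later ones) followed by an $H$-headed graph self-attention layer with input, embedding and output dimensions all $m$, followed by a final output MLP in $\Phi_{m,d',p}$. *)

(* Defs.v *)
From HB Require Import structures.
From mathcomp Require Import all_boot all_order all_algebra.
From mathcomp Require Import all_classical all_reals all_analysis.

Set Implicit Arguments.
Unset Strict Implicit.
Unset Printing Implicit Defensive.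

Import Order.TTheory GRing.Theory Num.Theory.

Local Open Scope ring_scope.

Definition real_mx (R : realType) (n k : nat) (X : 'M[bool]_(n, k)) :
  'M[R]_(n, k) := map_mx (fun b : bool => b%:R) X.

(* The j's need not be distinct, nor different from i, and X may have loops:
   this is the existence of a closed walk of length 5 through i. *)
Definition Cycle5 (N : nat) (X : 'M[bool]_N) : 'cV[bool]_N :=
  \col_i [exists j1 : 'I_N, exists j2 : 'I_N, exists j3 : 'I_N,
          exists j4 : 'I_N, [&& X i j1, X j1 j2, X j2 j3, X j3 j4 & X j4 i]].

(* The p-bit fixed-point numbers with scale 2 ^ e: z * 2 ^ e for a p-bit
   integer z, in two's complement if sg is true, unsigned otherwise. *)
Definition fixed_point (R : realType) (p : nat) (sg : bool) (e : int) (x : R) :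
    Prop :=
  exists z : int,
    (if sg then - (2 ^+ p.-1) <= z < 2 ^+ p.-1 else 0 <= z < 2 ^+ p)
    /\ x = z%:~R * 2 ^ e.

(* The rounding mode and the treatment of overflow are left open: rnd may be
   any map onto the representable numbers that leaves them unchanged. *)
Definition is_rounding (R : realType) (P : R -> Prop) (rnd : R -> R) : Prop :=
  (forall x, P (rnd x)) /\ (forall x, P x -> rnd x = x).

(* Phi_(d, d', p), for P the set of p-bit numbers and rnd the rounding onto it.
   A map on R^d has p-bit inputs when it reads each coordinate through rnd. *)
Definition is_mlp (R : realType) (P : R -> Prop) (rnd : R -> R) (d d' : nat)
    (phi : 'rV[R]_d -> 'rV[R]_d') : Prop :=
  (forall y, phi y = phi (map_mx rnd y)) /\ (forall y j, P (phi y 0 j)).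

Definition rowwise (R : realType) (N d d' : nat)
    (phi : 'rV[R]_d -> 'rV[R]_d') (Y : 'M[R]_(N, d)) : 'M[R]_(N, d') :=
  \matrix_(i < N) phi (row i Y).

Definition softmax (R : realType) (n k : nat) (A : 'M[R]_(n, k)) :
  'M[R]_(n, k) := \matrix_(i, j) (expR (A i j) / \sum_j' expR (A i j')).

Definition kappa_mx (R : realType) (N : nat) (kappa : bool -> bool -> R -> R)
    (X : 'M[bool]_N) (A : 'M[R]_N) : 'M[R]_N :=
  \matrix_(i, j) kappa (X i j) (X j i) (A i j).

Definition graph_attention_unit (R : realType) (N d m d' : nat)
    (kappa : bool -> bool -> R -> R) (Q K : 'M[R]_(d, m)) (V : 'M[R]_(d, d'))
    (X : 'M[bool]_N) (Y : 'M[R]_(N, d)) : 'M[R]_(N, d') :=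
  softmax (kappa_mx kappa X (Y *m Q *m K^T *m Y^T)) *m Y *m V.

Definition is_graph_attention_layer (R : realType) (P : R -> Prop)
    (N d m d' H : nat)
    (att : 'M[bool]_N -> 'M[R]_(N, d) -> 'M[R]_(N, d')) : Prop :=
  exists (kappa : 'I_H -> bool -> bool -> R -> R)
         (Q K : 'I_H -> 'M[R]_(d, m)) (V : 'I_H -> 'M[R]_(d, d')),
    [/\ forall h i j, P (Q h i j),
        forall h i j, P (K h i j),
        forall h i j, P (V h i j)
      & forall X Y, att X Y =
          \sum_(h < H) graph_attention_unit (kappa h) (Q h) (K h) (V h) X Y].

Inductive graph_blocks (R : realType) (P : R -> Prop) (rnd : R -> R)
    (N m H : nat) : nat -> ('M[bool]_N -> 'M[R]_(N, m)) -> Prop :=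
| graph_blocks1 (phi : 'rV[R]_N -> 'rV[R]_m) att :
    is_mlp P rnd phi ->
    is_graph_attention_layer P m H att ->
    graph_blocks P rnd H 1 (fun X => att X (rowwise phi (real_mx R X)))
| graph_blocksS D g (phi : 'rV[R]_m -> 'rV[R]_m) att :
    graph_blocks P rnd H D g ->
    is_mlp P rnd phi ->
    is_graph_attention_layer P m H att ->
    graph_blocks P rnd H D.+1 (fun X => att X (rowwise phi (g X))).

(* The class TG^(D, H)_(N, m, d', p). The input dimension is the number N of
   vertices, as the initial embedding of a vertex is its row of X. One
   fixed-point format serves the whole network; which one is not prescribed. *)
Definition graph_transformer (R : realType) (D H N m d' p : nat)
    (f : 'M[bool]_N -> 'M[R]_(N, d')) : Prop :=
  exists (sg : bool) (e : int) (rnd : R -> R),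
    is_rounding (fixed_point p sg e) rnd /\
    exists (g : 'M[bool]_N -> 'M[R]_(N, m)) (phi : 'rV[R]_m -> 'rV[R]_d'),
      [/\ graph_blocks (fixed_point p sg e) rnd H D g,
          is_mlp (fixed_point p sg e) rnd phi
        & forall X, f X = rowwise phi (g X)].

(* Main.v *)
(** A fooling-set argument. Blow up the 5-cycle to five classes of n = N/5
    vertices joined by perfect matchings, except that the edges from class 0 to
    class 1 are given by a set S of pairs and those from class 4 to class 3 by
    a set T. Each step of a walk moves one class forwards or backwards modulo
    5, so a closed walk of length 5 must wind once around, and one exists iff S
    meets T. The rows of classes 0, 1, 2 do not depend on T and those of
    classes 3, 4 do not depend on S.

    The transcript of the network on X is the list of the outputs of its D
    inner MLP layers, hence D * N * m numbers of p bits. Given these numbers, a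
    row of the output of an attention layer depends only on the same row and
    column of X. So if the inputs (S, ~: S) and (S', ~: S') have the same
    transcript, the input (S, ~: S') has it as well, and the network cannot see
    there a closed walk through a pair in S but not in S'. Transcripts
    therefore distinguish all the 2 ^ (n * n) sets S. *)
Require Import Defs.
From mathcomp Require Import all_boot all_order all_algebra.
From mathcomp Require Import all_classical all_reals all_analysis.
From mathcomp Require Import zify lra.

Set Implicit Arguments.
Unset Strict Implicit.
Unset Printing Implicit Defensive.

Import Order.TTheory GRing.Theory Num.Theory.

Local Open Scope ring_scope.

Lemma fixed_point_code (R : realType) (p : nat) (sg : bool) (e : int) :
  (0 < p)%N ->
  exists code : R -> 'I_(2 ^ p),
    forall x y, fixed_point p sg e x -> fixed_point p sg e y ->
      code x = code y -> x = y.
Proof.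
move=> p_gt0.
(* Adding [off] moves the signed and the unsigned range alike onto 0 .. 2 ^ p - 1; [code] then
   inverts [dec] on representable numbers. *)
pose off : int := if sg then 2 ^+ p.-1 else 0.
pose dec (k : 'I_(2 ^ p)) : R := (k%:Z - off)%:~R * 2 ^ e.
have dec_surj x : exists k, fixed_point p sg e x -> x = dec k.
  have [[z [hz ->]]|nPx] := pselect (fixed_point p sg e x); last first.
    by exists (Ordinal (expn_gt0 2 p : 0 < 2 ^ p)%N).
  have e2 : (2 : int) ^+ p = 2 * 2 ^+ p.-1 by rewrite -exprS prednK.
  have lo : 0 <= z + off by move: hz; rewrite /off; case: (sg) => /andP[] *; lia.
  have hi : (`|(z + off)%R| < 2 ^ p)%N.
    rewrite -ltz_nat gez0_abs // -natz natrX /off.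
    by move: hz; case: (sg) => /andP[] *; lia.
  exists (Ordinal hi) => _.
  by rewrite /dec /= gez0_abs // addrK.
have [code codeE] := choice dec_surj.
exists code => x y Px Py cxy.
by rewrite (codeE x Px) (codeE y Py) cxy.
Qed.

(** Row and column both matter, since [kappa] reads [X i j] and [X j i]. *)
Definition agree_at (N : nat) (i : 'I_N) (X X' : 'M[bool]_N) : Prop :=
  forall j, X i j = X' i j /\ X j i = X' j i.

Lemma attention_layer_local (R : realType) (P : R -> Prop) (N d m d' H : nat)
    (att : 'M[bool]_N -> 'M[R]_(N, d) -> 'M[R]_(N, d'))
    (X X' : 'M[bool]_N) (Y : 'M[R]_(N, d)) (i : 'I_N) :
  is_graph_attention_layer P m H att -> agree_at i X X' ->
  row i (att X Y) = row i (att X' Y).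
Proof.
move=> [kappa [Q [K [V [_ _ _ attE]]]]] XX'.
rewrite !attE !linear_sum; apply: eq_bigr => h _ /=.
rewrite /graph_attention_unit !row_mul; congr (_ *m _ *m _).
apply/rowP => j; rewrite ![row _ _ _ _]mxE ![softmax _ _ _]mxE.
have kE k : kappa_mx (kappa h) X (Y *m Q h *m (K h)^T *m Y^T) i k =
            kappa_mx (kappa h) X' (Y *m Q h *m (K h)^T *m Y^T) i k.
  by rewrite !mxE; have [-> ->] := XX' k.
by rewrite kE; congr (_ / _); apply: eq_bigr => k _; rewrite kE.
Qed.

Lemma row_rowwise (R : realType) (N d d' : nat)
    (phi : 'rV[R]_d -> 'rV[R]_d') (Y : 'M[R]_(N, d)) (i : 'I_N) :
  row i (rowwise phi Y) = phi (row i Y).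
Proof. by rewrite rowK. Qed.

(* tau X is the transcript, and X3 is obtained by giving the vertices in A
   their neighbourhoods in X1 and the others their neighbourhoods in X2. *)
Definition cut_and_paste (R : realType) (N m : nat) (T : Type)
    (tau : 'M[bool]_N -> T) (g : 'M[bool]_N -> 'M[R]_(N, m)) : Prop :=
  forall (A : pred 'I_N) (X1 X2 X3 : 'M[bool]_N), tau X1 = tau X2 ->
    (forall i, agree_at i X3 (if A i then X1 else X2)) ->
    forall i, row i (g X3) = row i (g (if A i then X1 else X2)).

Section Transcript.
Variables (R : realType) (P : R -> Prop) (rnd : R -> R) (C : finType).
Variable (code : R -> C).
Hypothesis code_inj : forall x y, P x -> P y -> code x = code y -> x = y.

(** Equal codes force equal MLP outputs on [X1] and [X2], and each MLP row on [X3] comes from one of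
    these. Attention thus receives the same embeddings on all three inputs, and locality
    concludes. *)
Lemma cut_and_paste_block (N d m H : nat) (T U : Type)
    (h : 'M[bool]_N -> 'M[R]_(N, d)) (phi : 'rV[R]_d -> 'rV[R]_m)
    (att : 'M[bool]_N -> 'M[R]_(N, m) -> 'M[R]_(N, m))
    (tau : 'M[bool]_N -> T) (sigma : 'M[bool]_N -> U) :
  cut_and_paste tau h -> is_mlp P rnd phi ->
  is_graph_attention_layer P m H att ->
  (forall X X', sigma X = sigma X' -> tau X = tau X' /\
     map_mx code (rowwise phi (h X)) = map_mx code (rowwise phi (h X'))) ->
  cut_and_paste sigma (fun X => att X (rowwise phi (h X))).
Proof.
move=> cph [_ Pphi] hatt sigmaE A X1 X2 X3 /sigmaE[t12 y12] X3A.
have Y12 : rowwise phi (h X1) = rowwise phi (h X2).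
  apply/matrixP => i j; apply: code_inj; rewrite ?mxE //.
  by have /matrixP/(_ i j) := y12; rewrite !mxE.
have Y3 : rowwise phi (h X3) = rowwise phi (h X1).
  apply/row_matrixP => i; rewrite !row_rowwise (cph _ _ _ _ t12 X3A).
  by case: (A i) => //; rewrite -!row_rowwise Y12.
move=> i; rewrite Y3.
have -> : rowwise phi (h X1) = rowwise phi (h (if A i then X1 else X2)).
  by case: (A i).
exact: attention_layer_local hatt (X3A i).
Qed.

Lemma graph_blocks_transcript (N m H D : nat)
    (g : 'M[bool]_N -> 'M[R]_(N, m)) :
  graph_blocks P rnd H D g ->
  exists tau : 'M[bool]_N -> D.-tuple 'M[C]_(N, m), cut_and_paste tau g.
Proof.
elim=> [phi att hphi hatt|{}D {}g phi att _ [tau cp] hphi hatt].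
- exists (fun X => [tuple map_mx code (rowwise phi (real_mx R X))]).
  (* The adjacency rows satisfy cut-and-paste with an empty transcript. *)
  have cp : cut_and_paste (fun=> tt) (@real_mx R N N).
    move=> A X1 X2 X3 _ X3A i; apply/rowP => j; rewrite !mxE.
    by have [->] := X3A i j.
  apply: (cut_and_paste_block cp) hphi hatt _ => X X' E; split=> //.
  by move: E => /(congr1 (@thead _ _)).
- exists (fun X => [tuple of map_mx code (rowwise phi (g X)) :: tau X]).
  apply: (cut_and_paste_block cp) hphi hatt _ => X X' [eY et].
  by split=> //; apply: val_inj.
Qed.

End Transcript.

(** Arcs run from class 3 to class 4, but pairs in [t] list the class 4 vertex first, hence the
    swap. *)
Definition pentagon_step (s t : rel nat) (q a b : nat) : bool :=
  match q with 0 => s a b | 3 => t b a | _ => a == b end%N.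

(** Without the bound on [u %/ n], the default 0 of [nth] would join leftover vertices to class
    0. *)
Definition pentagon_arc (s t : rel nat) (n u v : nat) : bool :=
  [&& (u %/ n < 5)%N, v %/ n == nth 0 [:: 1; 2; 3; 4; 0] (u %/ n)
    & pentagon_step s t (u %/ n) (u %% n) (v %% n)]%N.

(* Vertex q * n + r is the r-th vertex of class q; the vertices beyond 5 * n
   are isolated. *)
Definition pentagon_graph (s t : rel nat) (N n : nat) : 'M[bool]_N :=
  \matrix_(i, j) (pentagon_arc s t n i j || pentagon_arc s t n j i).

Lemma pentagon_graphC (s t : rel nat) (N n : nat) (i j : 'I_N) :
  pentagon_graph s t N n i j = pentagon_graph s t N n j i.
Proof. by rewrite !mxE orbC. Qed.

Definition on_t_side (N n : nat) (i : 'I_N) : bool :=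
  (i %/ n == 3)%N || (i %/ n == 4)%N.

Lemma pentagon_graph_agree (s s' t t' : rel nat) (N n : nat) (i : 'I_N) :
  agree_at i (pentagon_graph s t N n)
    (if ~~ on_t_side n i then pentagon_graph s t' N n
     else pentagon_graph s' t N n).
Proof.
suff E j : pentagon_graph s t N n i j =
    (if ~~ on_t_side n i then pentagon_graph s t' N n
     else pentagon_graph s' t N n) i j.
  move=> j; split=> //; rewrite pentagon_graphC E.
  by case: ifP => _; rewrite pentagon_graphC.
rewrite /on_t_side; case: ifP; rewrite !mxE /pentagon_arc;
  move: (i %/ n)%N (j %/ n)%N => [|[|[|[|[|q]]]]] [|[|[|[|[|q']]]]] //=.
Qed.

Lemma pentagon_Cycle5_disjoint (s t : rel nat) (N n : nat) (i : 'I_N) :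
  (forall a b, s a b -> t a b -> false) ->
  Cycle5 (pentagon_graph s t N n) i 0 = false.
Proof.
move=> st; apply/negP; rewrite mxE.
move=> /existsP[j1] /existsP[j2] /existsP[j3] /existsP[j4].
rewrite !mxE /pentagon_arc.
move: (i %% n)%N (j1 %% n)%N (j2 %% n)%N (j3 %% n)%N (j4 %% n)%N => a a1 a2 a3 a4.
move: (i %/ n)%N (j1 %/ n)%N (j2 %/ n)%N (j3 %/ n)%N (j4 %/ n)%N => q q1 q2 q3 q4.
(* Fixing one class at a time prunes early. Only walks going once around, in either direction,
   survive; their equalities identify the [s] pair with the [t] pair. *)
case/and5P; move: q q1 => [|[|[|[|[|q]]]]] [|[|[|[|[|q1]]]]] //=; rewrite ?orbF => e1;
  move: q2 => [|[|[|[|[|q2]]]]] //=; rewrite ?orbF => e2;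
  move: q3 => [|[|[|[|[|q3]]]]] //=; rewrite ?orbF => e3;
  move: q4 => [|[|[|[|[|q4]]]]] //=; rewrite ?orbF => e4 e5.
all: repeat match goal with H : is_true (_ == _) |- _ => move/eqP: H => H; subst end.
all: by eauto.
Qed.

Lemma pentagon_Cycle5_meet (s t : rel nat) (N n a b : nat) (i : 'I_N) :
  (5 * n <= N)%N -> (a < n)%N -> (b < n)%N -> s a b -> t a b -> i = a :> nat ->
  Cycle5 (pentagon_graph s t N n) i 0.
Proof.
move=> nN an bn sab tab ia.
have vtx q r : (q < 5)%N -> (r < n)%N ->
    exists2 j : 'I_N, (j %/ n = q)%N & (j %% n = r)%N.
  move=> q5 rn; have jN : (q * n + r < N)%N by nia.
  exists (Ordinal jN) => /=; last by rewrite modnMDl modn_small.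
  by rewrite divnMDl ?divn_small ?addn0 //; case: (n) rn.
(* The walk visits a, b, b, b, a in classes 0 to 4. *)
have [j1 q1 r1] := vtx 1%N b isT bn.
have [j2 q2 r2] := vtx 2%N b isT bn.
have [j3 q3 r3] := vtx 3%N b isT bn.
have [j4 q4 r4] := vtx 4%N a isT an.
rewrite mxE; apply/existsP; exists j1; apply/existsP; exists j2.
apply/existsP; exists j3; apply/existsP; exists j4.
rewrite !mxE /pentagon_arc q1 r1 q2 r2 q3 r3 q4 r4 ia.
by rewrite divn_small // modn_small //= sab tab !eqxx.
Qed.

Lemma Cycle5_transformer_bound (R : realType) (D H N m p n : nat)
    (f : 'M[bool]_N -> 'cV[R]_N) :
  (0 < p)%N -> (5 * n.+1 <= N)%N -> graph_transformer D H m p f ->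
  (forall X : 'M[bool]_N, X = X^T -> f X = real_mx R (Cycle5 X)) ->
  (n.+1 * n.+1 <= p * (N * m) * D)%N.
Proof.
move=> p_gt0 nN [sg [e [rnd [_ [g [phi [hg _ fE]]]]]]] f5.
have [code code_inj] := @fixed_point_code R p sg e p_gt0.
have [tau cp] := graph_blocks_transcript code_inj hg.
pose mem_rel (S : {set 'I_n.+1 * 'I_n.+1}) : rel nat :=
  fun a b => (inord a, inord b) \in S.
pose X S T := pentagon_graph (mem_rel S) (mem_rel T) N n.+1.
have f5X S T i : f (X S T) i 0 = (Cycle5 (X S T) i 0)%:R.
  rewrite f5 ?mxE //; apply/matrixP => u v.
  by rewrite [RHS]mxE pentagon_graphC.
have sub S S' : tau (X S (~: S)) = tau (X S' (~: S')) -> S \subset S'.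
  move=> tSS'; apply/fintype.subsetP => -[a b] abS; apply: contraT => abS'.
  have aN : (a < N)%N by have := ltn_ord a; lia.
  pose i := Ordinal aN.
  (* The pasted input is [X S (~: S')]. Vertex [a] of class 0 keeps its output on [X S (~: S)],
     which is 0, although (a, b) now closes a walk. *)
  have agree := pentagon_graph_agree (mem_rel S) (mem_rel S')
    (mem_rel (~: S')) (mem_rel (~: S)) (N := N) n.+1.
  have /(_ i) := cp (fun j => ~~ on_t_side n.+1 j) _ _ _ tSS' agree.
  rewrite /on_t_side divn_small //= => rowE.
  have : f (X S (~: S')) i 0 = f (X S (~: S)) i 0.
    by rewrite !fE !mxE rowE.
  rewrite !f5X [Cycle5 (X S (~: S)) _ _]pentagon_Cycle5_disjoint; last first.
    by move=> u v; rewrite /mem_rel finset.in_setC => ->.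
  rewrite (@pentagon_Cycle5_meet _ _ _ _ a b) //.
  - by move=> /eqP; rewrite oner_eq0.
  - by rewrite /mem_rel !inord_val.
  - by rewrite /mem_rel !inord_val finset.in_setC.
have inj : injective (fun S => tau (X S (~: S))).
  by move=> S S' E; apply/eqP; rewrite finset.eqEsubset !sub.
have := leq_card _ inj.
rewrite -[X in (X <= _)%N]cardsT -powersetT card_powerset cardsT card_prod.
by rewrite card_tuple card_mx !card_ord -!expnM leq_exp2l // !mulnA.
Qed.

Theorem theorem21 (R : realType) :
  exists c : R, 0 < c /\ exists N0 : nat,
    forall N m p H D : nat,
      (N0 <= N)%N -> (0 < m)%N -> (0 < p)%N -> (0 < H)%N -> (0 < D)%N ->
      (exists f : 'M[bool]_N -> 'cV[R]_N,
          graph_transformer D H m p f /\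
          (forall X : 'M[bool]_N, X = X^T -> f X = real_mx R (Cycle5 X))) ->
      c * N%:R / (ln N%:R) ^+ 2 <= (m * p * H * D)%N%:R.
Proof.
have ln5 : 0 < ln (5 : R) by apply: ln_gt0; rewrite ltr1n.
(* For N >= 5, N <= 10 * (N %/ 5); squaring gives the 100, and [ln 5 <= ln N] accounts for the
   logarithms. *)
exists (ln 5 ^+ 2 / 100); split; first by rewrite divr_gt0 ?exprn_gt0.
exists 5%N => N m p H D N5 m0 p0 H0 D0 [f [hf f5]].
have n1 : (N %/ 5).-1.+1 = (N %/ 5)%N by rewrite prednK // divn_gt0.
have nN : (5 * (N %/ 5).-1.+1 <= N)%N by rewrite n1; lia.
have := Cycle5_transformer_bound p0 nN hf f5; rewrite n1 => bound.
have NmpD : (N <= 100 * (m * p * H * D))%N.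
  have N10 : (N <= 10 * (N %/ 5))%N by lia.
  have : (N * N <= N * (100 * (m * p * D)))%N.
    have := leq_mul N10 N10; nia.
  rewrite leq_pmul2l; last by lia.
  move=> /leq_trans; apply; rewrite leq_pmul2l //.
  by rewrite leq_pmul2r // leq_pmulr.
have lnN : ln (5 : R) <= ln N%:R.
  by rewrite ler_ln ?posrE ?ltr0n ?ler_nat //; lia.
have lnN2 : ln (5 : R) ^+ 2 <= ln N%:R ^+ 2.
  by rewrite lerXn2r ?nnegrE ?(ltW ln5) // (le_trans (ltW ln5)).
rewrite ler_pdivrMr; last exact: lt_le_trans (exprn_gt0 2 ln5) lnN2.
have NmpDR : N%:R <= 100 * (m * p * H * D)%N%:R :> R.
  by rewrite -natrM ler_nat.
have := ler_pM (exprn_ge0 2 (ltW ln5)) (ler0n R N) lnN2 NmpDR.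
lra.
Qed.
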